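(* The following congruence holds modulo $p^3$ $${}_3F_2\!\left(\begin{matrix}\frac 12,\ \frac 12,\ \frac 12\\ 1,\ 1\end{matrix};\,1\right)_{p-1}=\sum_{k=0}^{p-1}\frac{\left(\frac12\right)_k^3}{k!^3}\equiv \left \{ \begin{array}{ll} - \Gamma_p\left(\frac14\right)^4 & \text{ if } p\equiv 1 \mod 4\\ -\frac{p^2}{16}\Gamma_p\left(\frac 14\right)^4 & \text{ if } p\equiv 3 \mod 4. \end{array} \right. $$
   Context: $p\ge 5$ is a prime. $(a)_k=a(a+1)\cdots(a+k-1)$ is the rising factorial, the subscript $p-1$ denotes truncation of the hypergeometric series ${}_3F_2$ after the $k=p-1$ term, and $\Gamma_p$ denotes the Morita $p$-adic Gamma function. *)

(* Defs.v *)
From HB Require Import structures.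
From mathcomp Require Import all_boot all_order all_algebra.
From mathcomp Require Import boolp classical_sets filter topology.

Set Implicit Arguments.
Unset Strict Implicit.
Unset Printing Implicit Defensive.

Import GRing.Theory.
Local Open Scope classical_set_scope.
Local Open Scope ring_scope.

Definition eqmodr (R : comNzRingType) (m x y : R) : Prop :=
  exists z : R, x - y = m * z.

Definition padic_red p n (a : 'Z_(p ^ n.+2)) : 'Z_(p ^ n.+1) := inZp a.

(* The ring Z_p, as the inverse limit of the rings Z / p^(n+1)Z.  The exponent *)
(* is shifted because 'Z_1 is not the zero ring.  This is the p-adic ring only *)
(* when 1 < p; for p = 0 and p = 1 it is a meaningless nonzero ring.           *)
Record padic_int (p : nat) := PadicInt {
  padic_res : forall n, 'Z_(p ^ n.+1);
  padic_res_coherent : forall n, padic_res n = padic_red (padic_res n.+1) }.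

Lemma padic_int_inj p (x y : padic_int p) :
  (forall n, padic_res x n = padic_res y n) -> x = y.
Proof.
case: x y => [x hx] [y hy] /= e.
have exy : x = y by apply: functional_extensionality_dep.
by subst y; congr PadicInt; apply: Prop_irrelevance.
Qed.

HB.instance Definition _ p := gen_eqMixin (padic_int p).
HB.instance Definition _ p := gen_choiceMixin (padic_int p).

Lemma Zp_trunc_dvd p n :
  ((Zp_trunc (p ^ n.+1)).+2 %| (Zp_trunc (p ^ n.+2)).+2)%N.
Proof.
case: p => [|[|p]]; first by rewrite !exp0n.
  by rewrite !exp1n.
have exp_gt1 k : (1 < p.+2 ^ k.+1)%N by rewrite -{1}(exp1n k.+1) ltn_exp2r.
by rewrite !Zp_cast ?dvdn_exp2l.
Qed.

Lemma padic_redD p n (a b : 'Z_(p ^ n.+2)) :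
  padic_red (a + b) = padic_red a + padic_red b.
Proof.
apply: val_inj; apply: etrans (modn_dvdm (a + b)%N (Zp_trunc_dvd p n)) _.
by rewrite /= modnDm.
Qed.

Lemma padic_redM p n (a b : 'Z_(p ^ n.+2)) :
  padic_red (a * b) = padic_red a * padic_red b.
Proof.
apply: val_inj; apply: etrans (modn_dvdm (a * b)%N (Zp_trunc_dvd p n)) _.
by rewrite /= modnMm.
Qed.

Lemma padic_red0 p n : padic_red (0 : 'Z_(p ^ n.+2)) = 0.
Proof. exact: val_inj. Qed.

Lemma padic_red1 p n : padic_red (1 : 'Z_(p ^ n.+2)) = 1.
Proof. exact: val_inj. Qed.

Lemma padic_redN p n (a : 'Z_(p ^ n.+2)) : padic_red (- a) = - padic_red a.
Proof. by apply/eqP; rewrite -addr_eq0 -padic_redD addNr padic_red0. Qed.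

Definition padic0 p : padic_int p :=
  PadicInt (fun n => esym (padic_red0 p n)).

Definition padic1 p : padic_int p :=
  PadicInt (fun n => esym (padic_red1 p n)).

Lemma padic_add_coherent p (x y : padic_int p) n :
  padic_res x n + padic_res y n = padic_red (padic_res x n.+1 + padic_res y n.+1).
Proof. by rewrite padic_redD -!padic_res_coherent. Qed.

Definition padic_add p (x y : padic_int p) : padic_int p :=
  PadicInt (padic_add_coherent x y).

Lemma padic_mul_coherent p (x y : padic_int p) n :
  padic_res x n * padic_res y n = padic_red (padic_res x n.+1 * padic_res y n.+1).
Proof. by rewrite padic_redM -!padic_res_coherent. Qed.

Definition padic_mul p (x y : padic_int p) : padic_int p :=
  PadicInt (padic_mul_coherent x y).

Lemma padic_opp_coherent p (x : padic_int p) n :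
  - padic_res x n = padic_red (- padic_res x n.+1).
Proof. by rewrite padic_redN -padic_res_coherent. Qed.

Definition padic_opp p (x : padic_int p) : padic_int p :=
  PadicInt (padic_opp_coherent x).

Lemma padic_addA p : associative (@padic_add p).
Proof. by move=> x y z; apply: padic_int_inj => n; exact: addrA. Qed.

Lemma padic_addC p : commutative (@padic_add p).
Proof. by move=> x y; apply: padic_int_inj => n; exact: addrC. Qed.

Lemma padic_add0 p : left_id (padic0 p) (@padic_add p).
Proof. by move=> x; apply: padic_int_inj => n; exact: add0r. Qed.

Lemma padic_addN p : left_inverse (padic0 p) (@padic_opp p) (@padic_add p).
Proof. by move=> x; apply: padic_int_inj => n; exact: addNr. Qed.

HB.instance Definition _ p := GRing.isZmodule.Build (padic_int p)
  (@padic_addA p) (@padic_addC p) (@padic_add0 p) (@padic_addN p).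

Lemma padic_mulA p : associative (@padic_mul p).
Proof. by move=> x y z; apply: padic_int_inj => n; exact: mulrA. Qed.

Lemma padic_mulC p : commutative (@padic_mul p).
Proof. by move=> x y; apply: padic_int_inj => n; exact: mulrC. Qed.

Lemma padic_mul1 p : left_id (padic1 p) (@padic_mul p).
Proof. by move=> x; apply: padic_int_inj => n; exact: mul1r. Qed.

Lemma padic_mulDl p : left_distributive (@padic_mul p) (@padic_add p).
Proof. by move=> x y z; apply: padic_int_inj => n; exact: mulrDl. Qed.

Lemma padic_1_neq0 p : padic1 p != 0.
Proof.
by apply/eqP => /(congr1 (fun x => padic_res x 0)) /= /eqP; rewrite oner_eq0.
Qed.

HB.instance Definition _ p := GRing.Zmodule_isComNzRing.Build (padic_int p)
  (@padic_mulA p) (@padic_mulC p) (@padic_mul1 p) (@padic_mulDl p)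
  (padic_1_neq0 p).

Definition padic_unit p : {pred padic_int p} :=
  fun x => `[< exists y, y * x = 1 >].

Definition padic_inv p (x : padic_int p) : padic_int p :=
  xget x [set y | y * x = 1].

Lemma padic_mulVx p : {in @padic_unit p, left_inverse 1 (@padic_inv p) *%R}.
Proof.
move=> x /asboolP[y yx1]; rewrite /padic_inv.
by case: xgetP => [z _ //|/(_ y)]; rewrite /= yx1.
Qed.

Lemma padic_unitPl p (x y : padic_int p) : y * x = 1 -> padic_unit x.
Proof. by move=> yx1; apply/asboolP; exists y. Qed.

Lemma padic_inv_out p : {in [predC @padic_unit p], @padic_inv p =1 id}.
Proof.
move=> x xNunit; rewrite /padic_inv; case: xgetP => [z _ /= zx1|//].
by move: xNunit; rewrite inE /= -[_ \in _]/(padic_unit x) (padic_unitPl zx1).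
Qed.

HB.instance Definition _ p := GRing.ComNzRing_hasMulInverse.Build (padic_int p)
  (@padic_mulVx p) (@padic_unitPl p) (@padic_inv_out p).

HB.instance Definition _ p := isPointed.Build (padic_int p) 0.

(* The p-adic topology: the sets x + p^k Z_p form a basis of neighborhoods of x *)
Definition padic_nbhs p (x : padic_int p) : set_system (padic_int p) :=
  filter_from setT (fun k => [set y | eqmodr (p%:R ^+ k) y x]).

HB.instance Definition _ p := hasNbhs.Build (padic_int p) (@padic_nbhs p).

Lemma padic_nbhs_filter p (x : padic_int p) : ProperFilter (nbhs x).
Proof.
apply: filter_from_proper; last first.
  by move=> k _; exists x; exists 0; rewrite subrr mulr0.
apply: filter_from_filter; first by exists 0%N.
move=> i j _ _; exists (i + j)%N => // y [z yxz]; split.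
  by exists (p%:R ^+ j * z); rewrite mulrA -exprD.
by exists (p%:R ^+ i * z); rewrite mulrA -exprD addnC.
Qed.

Lemma padic_nbhs_singleton p (x : padic_int p) (A : set (padic_int p)) :
  nbhs x A -> A x.
Proof. by case=> k _; apply; exists 0; rewrite subrr mulr0. Qed.

Lemma padic_nbhs_nbhs p (x : padic_int p) (A : set (padic_int p)) :
  nbhs x A -> nbhs x (nbhs^~ A).
Proof.
case=> k _ kA; exists k => // y [z yxz]; exists k => // t [u tyu].
by apply: kA; exists (u + z); rewrite mulrDr -tyu -yxz addrA subrK.
Qed.

HB.instance Definition _ p := Nbhs_isNbhsTopological.Build (padic_int p)
  (@padic_nbhs_filter p) (@padic_nbhs_singleton p) (@padic_nbhs_nbhs p).

(* (-1)^n times the product of the integers 0 < j < n prime to p *)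
Definition morita_gamma_nat (p n : nat) : padic_int p :=
  (-1) ^+ n * \prod_(1 <= j < n | ~~ (p %| j)%N) j%:R.

Definition nat_nbhs p (x : padic_int p) : set_system nat :=
  filter_from (nbhs x) (fun A => [set n : nat | A n%:R]).

(* Morita's definition: the extension of morita_gamma_nat to Z_p by continuity, *)
(* that is, its limit along the natural numbers n tending p-adically to x; the  *)
(* limit exists for all x when p is an odd prime.                               *)
Definition morita_gamma p (x : padic_int p) : padic_int p :=
  lim (morita_gamma_nat p n @[n --> nat_nbhs x]).

Definition pochhammer (R : nzRingType) (a : R) (k : nat) : R :=
  \prod_(i < k) (a + i%:R).

(* Truncation after the z^n term.  The implicit lower parameter 1 of the series *)
(* contributes the k!.                                                          *)
Definition hypergeometric_trunc (R : comUnitRingType) (as_ bs : seq R) (z : R)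
    (n : nat) : R :=
  \sum_(k < n.+1) (\prod_(a <- as_) pochhammer a k) /
    ((\prod_(b <- bs) pochhammer b k) * k`!%:R) * z ^+ k.

(* Main.v *)
From HB Require Import structures.
Require Import Defs.
From mathcomp Require Import all_boot all_order all_algebra.
From mathcomp Require Import ring zify boolp classical_sets filter topology.

Set Implicit Arguments.
Unset Strict Implicit.
Unset Printing Implicit Defensive.

Import GRing.Theory.
Local Open Scope ring_scope.

(* Put p = 2n + 1 and c = p^2, and compute in Z/p^3.  With                     *)
(*   v_j(u) = ((2j+1)^2 - u) / (4(j+1)^2),                                     *)
(*   SA(u) = sum_(k <= n) prod_(j < k) (2j+1)/(2(j+1)) v_j(u),                 *)
(*   SB(u) = sum_(k <= n) prod_(j < k) (n-j)/(2n-j) v_j(u),                    *)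
(* the truncated series is SA(0).  The weights of SA and SB agree modulo p, so *)
(* SA(c) - SA(0) = SB(c) - SB(0).  Now SA(c) is the terminating series         *)
(* 3F2(1/2, -n, n+1; 1, 1; 1), which Whipple's formula evaluates, and SB(u) is *)
(* the product of the ((4i+3)^2 - u)/(4(2i+1)(2i+2)) for i < n.                *)
(* If p = 3 mod 4, then SA(c) = SB(c) = 0, so the series is SB(0), whose       *)
(* factor with 4i+3 = p gives the p^2.  If p = 4m+1, then                      *)
(* SA(0) SB(c) = SA(c) SB(0), which simplifies to                              *)
(*   SA(0) = (-1)^m (3/4)_(2m)^2 / (m! (3m)!).                                 *)
(* By the reflection formula this is -q(2)^2 q(0)^2 q(-1) / q(3) where q(t) is *)
(* the p-adic Gamma function at 1/4 + tp/4.  The third multiplicative          *)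
(* differences of q are trivial, because the inverse squares of the nonzero    *)
(* residues modulo p sum to 0, so this quotient is -q(0)^4.                    *)

(** With u = x^2, the parameter [u] deforms (1/2)_k^2 into ((1-x)/2)_k ((1+x)/2)_k. At x = p these
    parameters are the integers -n and n+1, so the series terminates and has a closed form. The
    deformation from u = 0 changes each term by a multiple of p^2, so modulo p^3 it depends on the
    weights only modulo p. A second sum, with weights congruent modulo p but summable for every [u],
    therefore measures the change: this is [weighted_sum_diff] and [weighted_sum_cross]. The closed
    forms are [whipple_sum_odd], [whipple_sum_even] and [gosper_sumE]; they yield [weighted_sum_odd]
    and [weighted_sum_even].

    For p = 3 mod 4 the factor p^2 reduces the Gamma value to a factorial modulo p
    ([trunc_sum_mod3]). For p = 1 mod 4 it is needed modulo p^3, through [morita_prod_reflect] and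
    [morita_prod_quadratic] ([trunc_sum_mod1]). Finally [morita_gamma_mod] identifies the limit
    defining Gamma, modulo a power of p, with a finite product. *)

(** Closes goals that follow linearly from a known equation: the coefficient is supplied by hand,
    [ring] checks the last premise, and the unit [u] clears denominators. *)
Lemma linear_comb1 (R : comUnitRingType) (u c A B l r : R) :
  u \is a GRing.unit -> l = r -> u * (A - B) = c * (l - r) -> A = B.
Proof.
move=> uu -> /eqP; rewrite subrr mulr0 mulrI_eq0; last exact: mulrI.
by rewrite subr_eq0 => /eqP.
Qed.

Lemma linear_comb2 (R : comUnitRingType) (u c d A B l r l' r' : R) :
  u \is a GRing.unit -> l = r -> l' = r' ->
  u * (A - B) = c * (l - r) + d * (l' - r') -> A = B.
Proof.
move=> uu -> -> /eqP; rewrite !subrr !mulr0 addr0 mulrI_eq0; last exact: mulrI.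
by rewrite subr_eq0 => /eqP.
Qed.

Lemma linear_comb3 (R : comUnitRingType) (u c d e A B l r l' r' l'' r'' : R) :
  u \is a GRing.unit -> l = r -> l' = r' -> l'' = r'' ->
  u * (A - B) = c * (l - r) + d * (l' - r') + e * (l'' - r'') -> A = B.
Proof.
move=> uu -> -> -> /eqP; rewrite !subrr !mulr0 !addr0 mulrI_eq0; last exact: mulrI.
by rewrite subr_eq0 => /eqP.
Qed.

Lemma prodr_divS (R : comUnitRingType) (num den : nat -> R) k :
  den k \is a GRing.unit ->
  den k * (\prod_(j < k.+1) (num j / den j)) = num k * \prod_(j < k) (num j / den j).
Proof.
by move=> uk; rewrite big_ord_recr /= mulrCA mulrC [X in X * _]mulrC divrK.
Qed.

(** * Two terminating hypergeometric sums *)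

Section Whipple.
Variables (R : comUnitRingType) (N : nat).
Hypothesis u2 : (2 : R) \is a GRing.unit.
Hypothesis uN : forall j, (0 < j <= N)%N -> j%:R \is a @GRing.unit R.

(** This is (1/2)_k (-v)_k (v+1)_k / k!^3. The argument [v] is a ring element, so that the
    recurrence in [v] rests on polynomial identities. *)
Definition whipple_term (v : R) (k : nat) : R :=
  \prod_(j < k) ((2 * j%:R + 1) * (j%:R - v) * (j%:R + 1 + v) / (2 * (j%:R + 1) ^+ 3)).

(* Zeilberger certificate for the recurrence                                  *)
(*   (v+2)^2 S(v+2) = (v+1)^2 S(v),  S(v) = sum_k whipple_term v k:           *)
(* up to the factor 2v+3 it is the partial sum of the difference.             *)
Let cert (v : R) (k : nat) : R :=
  \prod_(j < k) (- ((2 * j%:R + 3) * (j%:R + 2 + v) * (v - j%:R + 1)) / (2 * (j%:R + 1) ^+ 3)).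

Lemma unit_2cube k : (k < N)%N -> 2 * (k%:R + 1) ^+ 3 \is a @GRing.unit R.
Proof. by move=> kN; rewrite rpredM ?rpredX // natr1 uN. Qed.

Lemma whipple_termS v k : (k < N)%N ->
  2 * (k%:R + 1) ^+ 3 * whipple_term v k.+1 =
  (2 * k%:R + 1) * (k%:R - v) * (k%:R + 1 + v) * whipple_term v k.
Proof.
move=> kN; apply: (@prodr_divS _ (fun j => (2 * j%:R + 1) * (j%:R - v) * (j%:R + 1 + v))
  (fun j => 2 * (j%:R + 1) ^+ 3)).
exact: unit_2cube.
Qed.

Let certS v k : (k < N)%N ->
  2 * (k%:R + 1) ^+ 3 * cert v k.+1 =
  - ((2 * k%:R + 3) * (k%:R + 2 + v) * (v - k%:R + 1)) * cert v k.
Proof.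
move=> kN; apply: (@prodr_divS _
  (fun j => - ((2 * j%:R + 3) * (j%:R + 2 + v) * (v - j%:R + 1)))
  (fun j => 2 * (j%:R + 1) ^+ 3)).
exact: unit_2cube.
Qed.

(** With [term2_cert], this writes both summands through [cert], which makes the induction step of
    [whipple_telescope] linear in [cert]. *)
Let term_cert v k : (k < N)%N ->
  2 * (k%:R + 1) ^+ 3 * whipple_term v k.+1 = - (v - k%:R) * (v - k%:R + 1) * cert v k.
Proof.
elim: k => [|k IH] kN.
  by rewrite whipple_termS // /whipple_term /cert !big_ord0; ring.
apply: (linear_comb3 (unit_2cube (ltnW kN)) (whipple_termS v kN)
  (IH (ltnW kN)) (certS v (ltnW kN))
  (c := 2 * (k%:R + 1) ^+ 3)
  (d := (2 * k%:R + 3) * (k%:R + 1 - v) * (k%:R + 2 + v))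
  (e := (v - k%:R - 1) * (v - k%:R))).
by rewrite -[k.+1%:R]natr1; ring.
Qed.

Let term2_cert v k : (k < N)%N ->
  2 * (k%:R + 1) ^+ 3 * whipple_term (v + 2) k.+1 =
  - (v + k%:R + 2) * (v + k%:R + 3) * cert v k.
Proof.
elim: k => [|k IH] kN.
  by rewrite whipple_termS // /whipple_term /cert !big_ord0; ring.
apply: (linear_comb3 (unit_2cube (ltnW kN)) (whipple_termS (v + 2) kN)
  (IH (ltnW kN)) (certS v (ltnW kN))
  (c := 2 * (k%:R + 1) ^+ 3)
  (d := (2 * k%:R + 3) * (k%:R + 1 - v - 2) * (k%:R + 4 + v))
  (e := (v + k%:R + 3) * (v + k%:R + 4))).
by rewrite -[k.+1%:R]natr1; ring.
Qed.

Lemma whipple_telescope v K : (K <= N)%N ->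
  \sum_(k < K.+1) ((v + 2) ^+ 2 * whipple_term (v + 2) k - (v + 1) ^+ 2 * whipple_term v k) =
  (2 * v + 3) * cert v K.
Proof.
elim: K => [|K IH] KN.
  by rewrite big_ord1 /whipple_term /cert !big_ord0; ring.
rewrite big_ord_recr /= IH 1?ltnW //.
apply: (linear_comb3 (unit_2cube KN) (term_cert v KN) (term2_cert v KN) (certS v KN)
  (c := - (v + 1) ^+ 2) (d := (v + 2) ^+ 2) (e := - (2 * v + 3))).
by ring.
Qed.

Lemma whipple_term_eq0 n k : (n < k)%N -> whipple_term n%:R k = 0.
Proof.
move=> nk; rewrite /whipple_term (bigD1 (Ordinal nk)) //=.
by rewrite subrr mulr0 !mul0r.
Qed.

Definition whipple_sum n : R := \sum_(k < n.+1) whipple_term n%:R k.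

Lemma whipple_sumSS n : (n.+2 <= N)%N ->
  n.+2%:R ^+ 2 * whipple_sum n.+2 = n.+1%:R ^+ 2 * whipple_sum n.
Proof.
move=> nN; apply/eqP; rewrite -subr_eq0; apply/eqP.
have ext : whipple_sum n = \sum_(k < n.+3) whipple_term n%:R k.
  by rewrite [RHS]big_ord_recr /= [X in X + _]big_ord_recr /=
    (@whipple_term_eq0 n n.+1) // (@whipple_term_eq0 n n.+2) // !addr0.
rewrite ext /whipple_sum !mulr_sumr -sumrB.
have := whipple_telescope n%:R nN; rewrite -natrD natr1 addn2 => ->.
(* The factor of [cert] at j = n+1 contains n - (n+1) + 1 = 0, so the boundary term vanishes. *)
rewrite /cert (bigD1 (Ordinal (ltnSn n.+1))) //= -natr1.
by rewrite [_ - _ + 1](_ : _ = 0) ?mulr0 ?oppr0 ?mul0r ?mulr0 //; ring.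
Qed.

Lemma whipple_sum_odd m : (m.*2.+1 <= N)%N -> whipple_sum m.*2.+1 = 0.
Proof.
elim: m => [|m IH] mN.
  rewrite /whipple_sum !big_ord_recr big_ord0 /= {1}/whipple_term big_ord0.
  apply: (linear_comb1 (c := 1) u2 (@whipple_termS 1%:R 0 mN)).
  by rewrite /whipple_term big_ord0; ring.
have mN' : (m.*2.+1 <= N)%N by apply: leq_trans mN; rewrite doubleS -addn2 leq_addr.
have := whipple_sumSS mN; rewrite IH // mulr0 -doubleS.
have uu : m.+1.*2.+1%:R \is a @GRing.unit R by rewrite uN ?mN.
by move=> e; apply: (mulrI (rpredX 2 uu)); rewrite mulr0.
Qed.

Lemma whipple_sum_even m : (m.*2 <= N)%N ->
  whipple_sum m.*2 = \prod_(i < m) ((2 * i%:R + 1) / (2 * (i%:R + 1))) ^+ 2.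
Proof.
elim: m => [|m IH] mN; first by rewrite /whipple_sum /whipple_term big_ord1 !big_ord0.
rewrite big_ord_recr /= -IH; last by apply: leq_trans mN; rewrite doubleS -addn2 leq_addr.
have := whipple_sumSS mN; rewrite -doubleS.
have -> : m.*2.+1%:R = 2 * m%:R + 1 :> R by rewrite -natr1 -mul2n natrM.
have -> : m.+1.*2%:R = 2 * (m%:R + 1) :> R by rewrite natr1 -mul2n natrM.
have uu : 2 * (m%:R + 1) \is a @GRing.unit R.
  by rewrite rpredM // natr1 uN // (leq_trans _ mN) // -addnn leq_addr.
move=> e; apply: (mulrI (rpredX 2 uu)).
rewrite e [RHS]mulrCA -exprMn [X in _ * X ^+ 2](mulrC (2 * (m%:R + 1))).
by rewrite divrK // mulrC.
Qed.
End Whipple.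

(** * A terminating sum of Watson's type *)

Section GosperSum.
Variables (R : comUnitRingType) (u : R) (N : nat).
Hypothesis u2 : (2 : R) \is a GRing.unit.
Hypothesis uN : forall j, (0 < j <= N)%N -> j%:R \is a @GRing.unit R.

(** With u = x^2, this is the k-th term of 3F2(-n, (1-x)/2, (1+x)/2; -2n, 1; 1), a terminating case
    of Watson's formula. *)
Definition gosper_term (n k : nat) : R :=
  \prod_(j < k) ((n%:R - j%:R) * ((2 * j%:R + 1) ^+ 2 - u) /
                 ((2 * n%:R - j%:R) * (4 * (j%:R + 1) ^+ 2))).

Let unit4 k : (k < N)%N -> 4 * (k%:R + 1) ^+ 2 \is a @GRing.unit R.
Proof.
move=> kN; rewrite (_ : 4 = 2 * 2); last by ring.
by rewrite !rpredM // natr1 uN.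
Qed.

Let unitB n k : (k < n <= N)%N -> n%:R - k%:R \is a @GRing.unit R.
Proof.
case/andP=> kn nN; rewrite -natrB 1?ltnW // uN // subn_gt0 kn.
by rewrite (leq_trans (leq_subr _ _) nN).
Qed.

Let unit2B n k : (k < n.*2 <= N)%N -> 2 * n%:R - k%:R \is a @GRing.unit R.
Proof. by move=> h; rewrite -natrM mul2n unitB. Qed.

Lemma gosper_termS n k : (k < n.*2 <= N)%N ->
  (2 * n%:R - k%:R) * (4 * (k%:R + 1) ^+ 2) * gosper_term n k.+1 =
  (n%:R - k%:R) * ((2 * k%:R + 1) ^+ 2 - u) * gosper_term n k.
Proof.
move=> kn; apply: (@prodr_divS _ (fun j => (n%:R - j%:R) * ((2 * j%:R + 1) ^+ 2 - u))
  (fun j => (2 * n%:R - j%:R) * (4 * (j%:R + 1) ^+ 2))).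
by case/andP: (kn) => kn1 nN; rewrite rpredM ?unit2B // unit4 // (leq_trans kn1).
Qed.

Let ltn_double k n : (k < n -> k < n.*2)%N.
Proof. by move=> kn; rewrite (leq_trans kn) // -addnn leq_addr. Qed.

Let gosper_term_succ n k : (k <= n)%N -> (n.+1.*2 <= N)%N ->
  2 * (2 * n%:R + 1) * (n%:R + 1 - k%:R) * gosper_term n.+1 k =
  (2 * n%:R + 2 - k%:R) * (2 * n%:R + 1 - k%:R) * gosper_term n k.
Proof.
elim: k => [|k IH] kn nN; first by rewrite /gosper_term !big_ord0; ring.
have nN' : (n.*2 <= N)%N by rewrite (leq_trans _ nN) // leq_double.
have k1 : (k < n.+1.*2)%N by rewrite ltn_double // ltnW.
have kS : (k < n.+1.*2 <= N)%N by rewrite k1.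
have kS' : (k < n.*2 <= N)%N by rewrite nN' ltn_double.
have uu : 4 * (k%:R + 1) ^+ 2 * (2 * (n%:R + 1) - k%:R) \is a @GRing.unit R.
  by rewrite rpredM ?unit4 ?(leq_trans k1) // natr1 unit2B.
apply: (linear_comb3 uu (gosper_termS kS) (gosper_termS kS') (IH (ltnW kn) nN)
  (c := 2 * (2 * n%:R + 1) * (n%:R - k%:R))
  (d := - (2 * n%:R + 2 - k%:R) * (2 * n%:R + 1 - k%:R))
  (e := ((2 * k%:R + 1) ^+ 2 - u) * (n%:R - k%:R))).
by rewrite -[k.+1%:R]natr1 -[n.+1%:R]natr1; ring.
Qed.

(** Zeilberger's method again: here the certificate is the summand itself times a polynomial. *)
Lemma gosper_telescope n K : (K <= n)%N -> (n.+1.*2 <= N)%N ->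
  8 * (2 * n%:R + 1) * (n%:R + 1) * (\sum_(k < K.+1) gosper_term n.+1 k) -
  ((4 * n%:R + 3) ^+ 2 - u) * (\sum_(k < K.+1) gosper_term n k) =
  - gosper_term n K * ((2 * K%:R + 1) ^+ 2 - u).
Proof.
elim: K => [|K IH] Kn nN; first by rewrite !big_ord1 /gosper_term !big_ord0; ring.
rewrite !(big_ord_recr K.+1) /=.
have nN' : (n.*2 <= N)%N by rewrite (leq_trans _ nN) // leq_double.
have kS' : (K < n.*2 <= N)%N by rewrite nN' ltn_double.
have uu : n%:R - K%:R \is a @GRing.unit R.
  by rewrite unitB // Kn (leq_trans _ nN') // -addnn leq_addr.
apply: (linear_comb3 uu (IH (ltnW Kn) nN) (gosper_term_succ Kn nN) (gosper_termS kS')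
  (c := n%:R - K%:R) (d := 4 * (n%:R + 1)) (e := 1)).
by rewrite -[K.+1%:R]natr1; ring.
Qed.

Definition gosper_sum n := \sum_(k < n.+1) gosper_term n k.

(** The boundary term at K = n cancels against the last term k = n+1 of [gosper_sum n.+1], which the
    telescoped partial sum leaves out. *)
Lemma gosper_sumS n : (n.+1.*2 <= N)%N ->
  8 * (2 * n%:R + 1) * (n%:R + 1) * gosper_sum n.+1 = ((4 * n%:R + 3) ^+ 2 - u) * gosper_sum n.
Proof.
move=> nN; rewrite {1}/gosper_sum big_ord_recr /=.
have nS : (n < n.+1.*2 <= N)%N by rewrite ltn_double.
have uu : (n%:R + 1) * (n%:R + 2) \is a @GRing.unit R.
  rewrite natr1 -natrD rpredM // uN // (leq_trans _ nN) ?addn2 //.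
    by rewrite -addnn leq_addr.
  by rewrite doubleS !ltnS -addnn leq_addr.
apply: (linear_comb3 uu
  (gosper_telescope (leqnn n) nN) (gosper_term_succ (leqnn n) nN) (gosper_termS nS)
  (c := (n%:R + 1) * (n%:R + 2)) (d := ((2 * n%:R + 1) ^+ 2 - u))
  (e := 2 * (2 * n%:R + 1))).
by rewrite /gosper_sum -[n.+1%:R]natr1; ring.
Qed.

Lemma gosper_sumE n : (n.*2 <= N)%N ->
  4 ^+ n * n.*2`!%:R * gosper_sum n = \prod_(i < n) ((4 * i%:R + 3) ^+ 2 - u).
Proof.
elim: n => [|n IH] nN; first by rewrite /gosper_sum /gosper_term big_ord1 !big_ord0 !mulr1.
have nN' : (n.*2 <= N)%N by rewrite (leq_trans _ nN) // leq_double.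
have dE : n.*2%:R = 2 * n%:R :> R by rewrite -mul2n natrM.
rewrite big_ord_recr /= -IH //.
apply: (linear_comb1 (c := 4 ^+ n * n.*2`!%:R) (unitr1 R) (gosper_sumS nN)).
by rewrite exprS doubleS !factS !natrM -[n.*2.+2%:R]natr1 -[n.*2.+1%:R]natr1
  dE; ring.
Qed.
End GosperSum.

(** * The truncated series modulo the cube of p *)

Lemma prodr_perturb (R : comNzRingType) (c : R) k (x y : nat -> R) :
  exists e, \prod_(j < k) (x j + c * y j) = \prod_(j < k) x j + c * e.
Proof.
elim: k => [|k [e IH]]; first by exists 0; rewrite !big_ord0 mulr0 addr0.
exists (\prod_(j < k) x j * y k + e * x k + c * e * y k).
by rewrite !big_ord_recr /= IH; ring.
Qed.

Lemma eq_mulr_prod (R : comNzRingType) (c : R) k (x y : nat -> R) :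
  (forall j, (j < k)%N -> c * x j = c * y j) ->
  c * \prod_(j < k) x j = c * \prod_(j < k) y j.
Proof.
elim: k => [|k IH] xy; first by rewrite !big_ord0.
rewrite !big_ord_recr /= mulrA IH => [|j jk]; last by rewrite xy // ltnW.
by rewrite mulrAC xy // mulrAC mulrA.
Qed.

Lemma eq_mulr_div (R : comUnitRingType) (c x y x' y' : R) :
  y \is a GRing.unit -> y' \is a GRing.unit ->
  c * (x * y') = c * (x' * y) -> c * (x / y) = c * (x' / y').
Proof.
move=> uy uy' e; apply: (mulIr uy'); apply: (mulIr uy).
transitivity (c * (x * y') * (y^-1 * y)); first by ring.
rewrite mulVr // mulr1 e -[LHS]mulr1 -(mulVr uy'); ring.
Qed.

Lemma big_ord_shift (T : Type) (idx : T) (op : Monoid.com_law idx) t (F : nat -> T) a :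
  (forall j, F (j + t)%N = F j) ->
  \big[op/idx]_(i < t) F (a + i)%N = \big[op/idx]_(i < t) F i.
Proof.
case: t => [|t] Ft; first by rewrite !big_ord0.
elim: a => [//|a <-]; rewrite big_ord_recr big_ord_recl /= addn0 Monoid.mulmC.
rewrite addSnnS Ft; congr (op _ _).
by apply: eq_bigr => i _; rewrite addSnnS.
Qed.

(** * Morita's products in an arbitrary ring *)

Definition morita_prod (R : nzRingType) (p n : nat) : R :=
  (-1) ^+ n * \prod_(1 <= j < n | ~~ (p %| j)%N) j%:R.

Section MoritaProd.
Variables (R : comNzRingType) (p : nat).
Local Notation gam := (morita_prod R p).

(** Multiples of p, including 0, contribute 1, so that products over whole intervals can be used. *)
Definition prime_part (j : nat) : R := if (p %| j)%N then 1 else j%:R.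

Lemma morita_prod0 : gam 0 = 1.
Proof. by rewrite /morita_prod big_geq ?mulr1. Qed.

Lemma morita_prodS n : gam n.+1 = - prime_part n * gam n.
Proof.
have e : \prod_(1 <= j < n.+1 | ~~ (p %| j)%N) j%:R =
    (\prod_(1 <= j < n | ~~ (p %| j)%N) j%:R) * prime_part n.
  case: n => [|n]; first by rewrite !big_geq // /prime_part dvdn0 mulr1.
  rewrite big_mkcond big_nat_recr //= -big_mkcond /= /prime_part.
  by case: (p %| n.+1)%N.
by rewrite /morita_prod e exprS; ring.
Qed.

Lemma morita_prodD a k :
  gam (a + k) = (-1) ^+ k * \prod_(i < k) prime_part (a + i) * gam a.
Proof.
elim: k => [|k IH]; first by rewrite addn0 big_ord0 !mul1r.
by rewrite addnS morita_prodS IH big_ord_recr exprS /=; ring.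
Qed.

Lemma morita_prod_fact k : (k < p)%N -> gam k.+1 = (-1) ^+ k.+1 * k`!%:R.
Proof.
elim: k => [|k IH] kp; first by rewrite morita_prodS morita_prod0 /prime_part dvdn0 fact0; ring.
rewrite morita_prodS IH ?(ltnW kp) // /prime_part gtnNdvd //= factS natrM [in RHS]exprS.
by ring.
Qed.
End MoritaProd.

(** * Comparison of the two weighted sums *)

Section TruncatedSum.
Variables (R : comUnitRingType) (p n : nat).
Hypotheses (pr_p : prime p) (pE : p = n.*2.+1).
Hypothesis p3 : p%:R ^+ 3 = 0 :> R.
Hypothesis up : forall j, ~~ (p %| j)%N -> j%:R \is a @GRing.unit R.

(* Since c * p = 0, an equation c * x = c * y says that x and y agree modulo p. *)
Local Notation c := (p%:R ^+ 2).

Lemma unit_ltp j : (0 < j < p)%N -> j%:R \is a @GRing.unit R.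
Proof. by case/andP=> j0 jp; rewrite up // gtnNdvd. Qed.

Lemma pE_ring : p%:R = 2 * n%:R + 1 :> R.
Proof. by rewrite pE -natr1 -mul2n natrM. Qed.

Lemma sqrp_mulp (x : R) : c * (p%:R * x) = 0.
Proof. by rewrite mulrA -exprSr p3 mul0r. Qed.

Lemma sqrp_sqrp (x : R) : c * (c * x) = 0.
Proof. by rewrite mulrA -exprD (exprD _ 3 1) p3 !mul0r. Qed.

Lemma half_lt_p : (n < p)%N. Proof. by rewrite pE ltnS -addnn leq_addr. Qed.

Lemma unit2 : (2 : R) \is a GRing.unit.
Proof.
rewrite up // pE; case: n pE => [|m] e; last by rewrite gtnNdvd.
by move: pr_p; rewrite e.
Qed.

Lemma unit4 : (4 : R) \is a GRing.unit.
Proof. by rewrite (_ : 4 = 2 * 2); [rewrite rpredM ?unit2 | ring]. Qed.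

Lemma unit_le2n j : (0 < j <= n.*2)%N -> j%:R \is a @GRing.unit R.
Proof. by move=> h; rewrite unit_ltp // pE ltnS. Qed.

(** The two weights are (1/2)_k / k! and (-n)_k / (-2n)_k; modulo p = 2n+1 the parameters -n and -2n
    become 1/2 and 1. *)
Definition half_ratio k : R := \prod_(j < k) ((2 * j%:R + 1) / (2 * (j%:R + 1))).
Definition neg_ratio k : R := \prod_(j < k) ((n%:R - j%:R) / (2 * n%:R - j%:R)).
Definition square_ratio (u : R) k : R :=
  \prod_(j < k) (((2 * j%:R + 1) ^+ 2 - u) / (4 * (j%:R + 1) ^+ 2)).

Lemma square_ratio_perturb k :
  exists e, square_ratio c k = square_ratio 0 k + c * e.
Proof.
have [e eE] := @prodr_perturb R c k (fun j => ((2 * j%:R + 1) ^+ 2 - 0) / (4 * (j%:R + 1) ^+ 2))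
  (fun j => - (4 * (j%:R + 1) ^+ 2)^-1).
by exists e; rewrite -eE; apply: eq_bigr => j _; rewrite subr0 mulrN mulrBl.
Qed.

Lemma unit_den k : (k < n)%N -> [/\ k%:R + 1 \is a @GRing.unit R,
  2 * n%:R - k%:R \is a @GRing.unit R & 4 * (k%:R + 1) ^+ 2 \is a @GRing.unit R].
Proof.
move=> kn; have kp := leq_ltn_trans kn half_lt_p.
have k2n : (k < n.*2)%N by rewrite (leq_trans kn) // -addnn leq_addr.
have u1 : k%:R + 1 \is a @GRing.unit R by rewrite natr1 unit_ltp.
split=> //; last first.
  by rewrite rpredM ?rpredX ?unit4.
rewrite -natrM mul2n -natrB 1?ltnW // unit_le2n // subn_gt0 k2n.
exact: leq_subr.
Qed.

Lemma half_neg_ratio k : (k <= n)%N -> c * half_ratio k = c * neg_ratio k.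
Proof.
move=> kn; apply: (@eq_mulr_prod R c k (fun j => (2 * j%:R + 1) / (2 * (j%:R + 1)))
  (fun j => (n%:R - j%:R) / (2 * n%:R - j%:R))) => j jk.
have [u1 v1 _] := unit_den (leq_trans jk kn).
apply: eq_mulr_div; rewrite ?rpredM ?unit2 //.
apply/eqP; rewrite -subr_eq0 -mulrBr; apply/eqP.
(* The cross difference (2j+1)(2n-j) - 2(j+1)(n-j) equals pj. *)
by rewrite -[RHS](sqrp_mulp j%:R); congr (_ * _); rewrite pE_ring; ring.
Qed.

Definition weighted_sum (r : nat -> R) (u : R) : R := \sum_(k < n.+1) r k * square_ratio u k.

Local Notation SA := (weighted_sum half_ratio).
Local Notation SB := (weighted_sum neg_ratio).

(** Since p = 2n+1, (2j+1)^2 - p^2 = 4(j-n)(j+n+1). *)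
Lemma weighted_sum_whipple : SA c = whipple_sum R n.
Proof.
apply: eq_bigr => -[k kn] _ /=; rewrite -big_split; apply: eq_bigr => -[j jk] _ /=.
have [u1 _ v1] := unit_den (leq_trans jk kn).
rewrite mulrACA -invrM ?rpredM ?unit2 ?unit4 // -[LHS]mul1r -[RHS]mul1r.
apply: eq_mulr_div; rewrite ?rpredM ?rpredX ?unit2 ?unit4 //.
by rewrite pE_ring; ring.
Qed.

Lemma weighted_sum_gosper u : SB u = gosper_sum u n.
Proof.
apply: eq_bigr => -[k kn] _ /=; rewrite -big_split; apply: eq_bigr => -[j jk] _ /=.
have [u1 v1 w1] := unit_den (leq_trans jk kn).
by rewrite mulrACA -invrM // [4 * _ * _]mulrC.
Qed.

Lemma half_neg_sum : c * SA 0 = c * SB 0.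
Proof.
rewrite !mulr_sumr; apply: eq_bigr => -[k kn] _ /=.
by rewrite mulrA half_neg_ratio // -mulrA.
Qed.

(** Each [square_ratio] changes by a multiple of p^2, and after multiplication by p^2 the two
    weights coincide, so one [e] serves both sums. *)
Lemma weighted_sum_diff : exists2 e, SA c = SA 0 + c * e & SB c = SB 0 + c * e.
Proof.
have [e eE] := choice square_ratio_perturb.
exists (\sum_(k < n.+1) half_ratio k * e k).
  rewrite mulr_sumr -big_split; apply: eq_bigr => k _ /=.
  by rewrite eE; ring.
rewrite mulr_sumr -big_split; apply: eq_bigr => -[k kn] _ /=.
by rewrite [RHS]addrC mulrA half_neg_ratio // eE; ring.
Qed.

(** The two sides exceed [SA 0 * SB 0] by [c * e * SA 0] and [c * e * SB 0], which are equal by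
    [half_neg_sum]. *)
Lemma weighted_sum_cross : SA 0 * SB c = SA c * SB 0.
Proof.
have [e eA eB] := weighted_sum_diff.
apply: (linear_comb2 (unitr1 _) half_neg_sum (sqrp_sqrp (e ^+ 2)) (c := e) (d := 0)).
by rewrite eA eB; ring.
Qed.

Lemma unit_fact k : (k < p)%N -> k`!%:R \is a @GRing.unit R.
Proof.
elim: k => [|k IH] kp; first exact: unitr1.
by rewrite factS natrM rpredM ?IH ?(ltnW kp) // unit_ltp.
Qed.

Lemma half_ratioE k : (k < p)%N ->
  half_ratio k = (\prod_(i < k) (2^-1 + i%:R)) / k`!%:R.
Proof.
elim: k => [|k IH] kn; first by rewrite /half_ratio !big_ord0 divr1.
rewrite /half_ratio !big_ord_recr /= -/(half_ratio k) IH 1?ltnW //.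
rewrite factS natrM -[k.+1%:R]natr1.
have uk : k%:R + 1 \is a @GRing.unit R by rewrite natr1 unit_ltp.
have -> : 2^-1 + k%:R = (2 * k%:R + 1) * 2^-1 :> R.
  by rewrite mulrDl mulrAC divrr ?unit2 // !mul1r addrC.
by rewrite [(2 * _)^-1]invrM ?unit2 // invrM ?unit_fact ?(ltnW kn) //; ring.
Qed.

Lemma square_ratio0 k : (k <= n)%N -> square_ratio 0 k = half_ratio k ^+ 2.
Proof.
move=> kn; rewrite /half_ratio -prodrXl; apply: eq_bigr => -[j jk] _ /=.
have [u1 _ _] := unit_den (leq_trans jk kn).
rewrite subr0 exprMn exprVn exprMn; congr (_ / (_ * _)); ring.
Qed.

Lemma trunc_sumE :
  \sum_(0 <= k < p) (\prod_(i < k) (2^-1 + i%:R)) ^+ 3 / k`!%:R ^+ 3 = SA 0.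
Proof.
rewrite (big_cat_nat (n := n.+1)) //=; last exact: half_lt_p.
rewrite [X in _ + X]big_nat_cond [X in _ + X]big1 ?addr0.
  rewrite big_mkord; apply: eq_bigr => -[k kn] _ /=.
  rewrite -exprVn -exprMn -half_ratioE ?(leq_ltn_trans _ half_lt_p) //.
  by rewrite square_ratio0 // exprS.
move=> k; rewrite andbT => /andP[nk _].
(* For k > n the product contains 1/2 + n = p/2, whose cube is 0. *)
rewrite (bigD1 (Ordinal nk)) //= exprMn.
have -> : 2^-1 + n%:R = 2^-1 * p%:R :> R.
  by rewrite pE_ring mulrDr mulrA mulVr ?unit2 // mul1r mulr1 addrC.
by rewrite exprMn p3 mulr0 !mul0r.
Qed.

Lemma fermat_perturb : c * 4 ^+ n = c :> R.
Proof.
have /eqP := fermat_little 2 pr_p; rewrite eqn_mod_dvd; last first.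
  by rewrite -{1}(expn1 2) leq_exp2l // prime_gt0.
case/dvdnP=> q; rewrite {1}pE expnS -mul2n expnM => qE.
have {}qE : (2 * 4 ^ n = q * p + 2)%N.
  by rewrite -qE subnK // leq_pmulr // expn_gt0.
apply: (linear_comb2 unit2 (congr1 (fun k => k%:R : R) qE) (sqrp_mulp q%:R) (c := c) (d := 1)).
by rewrite natrD !natrM natrX; ring.
Qed.

Lemma fact_perturb : c * n.*2`!%:R = - c :> R.
Proof.
have := Wilson (prime_gt1 pr_p); rewrite pr_p => /esym /dvdnP[q].
rewrite {1}pE /= => qE.
apply: (linear_comb2 (unitr1 _) (congr1 (fun k => k%:R : R) qE) (sqrp_mulp q%:R) (c := c) (d := 1)).
by rewrite -natr1 natrM; ring.
Qed.

Lemma unit_gosper_den : 4 ^+ n * n.*2`!%:R \is a @GRing.unit R.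
Proof. by rewrite rpredM ?rpredX ?unit4 // unit_fact // pE. Qed.

Lemma neg_sum_prod u :
  4 ^+ n * n.*2`!%:R * SB u = \prod_(i < n) ((4 * i%:R + 3) ^+ 2 - u).
Proof.
by rewrite weighted_sum_gosper (@gosper_sumE _ u n.*2 unit2) //; exact: unit_le2n.
Qed.

Lemma prodr_center s (f : nat -> R) :
  \prod_(i < s.*2.+1) f i = f s * \prod_(l < s) (f (s - l.+1)%N * f (s + l.+1)%N).
Proof.
elim: s f => [|s IH] f; first by rewrite big_ord_recl !big_ord0.
rewrite doubleS big_ord_recr big_ord_recl /= (IH (fun i => f i.+1)) big_ord_recr /=.
rewrite subnn addSn addnS addnn.
have -> : \prod_(l < s) (f (s - l.+1).+1 * f (s + l.+1).+1) =
    \prod_(l < s) (f (s.+1 - l.+1)%N * f (s.+1 + l.+1)%N).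
  by apply: eq_bigr => -[l ls] _ /=; rewrite subSS subnSK.
by ring.
Qed.

Lemma weighted_sum_odd s : n = s.*2.+1 -> 16 * SA 0 = - c * s`!%:R ^+ 4 :> R.
Proof.
move=> ns.
have uN j : (0 < j <= n.*2)%N -> j%:R \is a @GRing.unit R by exact: unit_le2n.
have SA0 : SA c = 0.
  rewrite weighted_sum_whipple ns (@whipple_sum_odd _ n.*2 unit2 uN) //.
  by rewrite -ns -addnn leq_addr.
have pS : p%:R = 4 * s%:R + 3 :> R.
  by rewrite pE_ring ns -[s.*2.+1%:R]natr1 -mul2n natrM; ring.
have SB0 : SB c = 0.
  apply: (mulrI unit_gosper_den); rewrite mulr0 neg_sum_prod.
  have sn : (s < n)%N by rewrite ns ltnS -addnn leq_addr.
  by rewrite (bigD1 (Ordinal sn)) //= -pS subrr mul0r.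
have [e eA eB] := weighted_sum_diff.
have -> : SA 0 = SB 0.
  by apply: (addIr (c * e)); rewrite -eA -eB SA0 SB0.
have prodE : \prod_(i < n) ((4 * i%:R + 3) ^+ 2 - 0) = c *
    (\prod_(l < s) ((p%:R - 4 * l.+1%:R) * (p%:R + 4 * l.+1%:R))) ^+ 2 :> R.
  (* The middle factor i = s is p^2; the factors at distance l from it are (p - 4l)^2 and (p +
     4l)^2. *)
  rewrite ns (prodr_center s (fun i => (4 * i%:R + 3) ^+ 2 - 0)) -pS subr0; congr (_ * _).
  rewrite -prodrXl; apply: eq_bigr => -[l ls] _ /=.
  by rewrite natrB // natrD !subr0 exprMn pS; congr (_ ^+ 2 * _ ^+ 2); ring.
have prod_eq : c * (\prod_(l < s) ((p%:R - 4 * l.+1%:R) * (p%:R + 4 * l.+1%:R))) ^+ 2 =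
    c * (16 ^+ s * s`!%:R ^+ 2) ^+ 2 :> R.
  rewrite -prodrXl fact_prod big_add1 big_mkord natr_prod -prodrXl.
  rewrite (_ : 16 ^+ s = \prod_(l < s) 16); last by rewrite prodr_const card_ord.
  rewrite -big_split -prodrXl /=.
  apply: (@eq_mulr_prod R c s
    (fun l => ((p%:R - 4 * l.+1%:R) * (p%:R + 4 * l.+1%:R)) ^+ 2)
    (fun l => (16 * l.+1%:R ^+ 2) ^+ 2)) => l ls.
  apply/eqP; rewrite -subr_eq0 -mulrBr; apply/eqP.
  rewrite -[RHS](sqrp_mulp (p%:R * (p%:R ^+ 2 - 32 * l.+1%:R ^+ 2))); congr (_ * _); ring.
apply: (mulrI unit_gosper_den).
(* Next to p^2, the powers of 4 and (2n)! matter only modulo p, where Fermat and Wilson evaluate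
   them. *)
have := neg_sum_prod 0; rewrite prodE prod_eq => e1; have := fermat_perturb.
rewrite (_ : 4 ^+ n = 4 * 16 ^+ s :> R) in e1 *; last first.
  by rewrite ns -mul2n exprS exprM (_ : 4 ^+ 2 = 16) //; ring.
move=> e2; apply: (linear_comb3 (unitr1 R) e1 e2 fact_perturb
  (c := 16) (d := 4 * 16 ^+ s * s`!%:R ^+ 4) (e := 4 * 16 ^+ s * s`!%:R ^+ 4)).
by ring.
Qed.

Lemma unit_odd_prod m : (m <= n)%N -> \prod_(i < m) (2 * i%:R + 1) \is a @GRing.unit R.
Proof.
move=> mn; rewrite rpred_prod // => -[i im] _ /=.
by rewrite -natrM natr1 unit_ltp // pE mul2n !ltnS ltn_double (leq_trans im).
Qed.

Lemma half_ratio_odd m : (m <= n)%N ->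
  2 ^+ m * m`!%:R * half_ratio m = \prod_(i < m) (2 * i%:R + 1).
Proof.
elim: m => [|m IH] mn; first by rewrite /half_ratio !big_ord0 !mulr1.
rewrite /half_ratio !big_ord_recr /= -/(half_ratio m) -IH 1?ltnW //.
have [u1 _ _] := unit_den mn.
have uD : 2 * (m%:R + 1) \is a @GRing.unit R by rewrite rpredM ?unit2.
apply: (linear_comb1 (unitr1 R) (divrr uD) (c := 2 ^+ m * m`!%:R * half_ratio m * (2 * m%:R + 1))).
by rewrite exprS factS natrM -[m.+1%:R]natr1; ring.
Qed.

(** Solves [weighted_sum_cross] for [SA 0]. The square of (2m-1)!! occurs both in the product for
    [SB c] and in Whipple's value of [SA c], and cancels. *)
Lemma weighted_sum_even m (y : R) : n = m.*2 -> 4 * y = 1 ->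
  SA 0 * (m`!%:R * (3 * m)`!%:R) = (-1) ^+ m * (\prod_(i < n) (3 * y + i%:R)) ^+ 2.
Proof.
move=> nm y4.
have uN j : (0 < j <= n.*2)%N -> j%:R \is a @GRing.unit R by exact: unit_le2n.
have mn : (m <= n)%N by rewrite nm -addnn leq_addr.
have SAc : SA c = half_ratio m ^+ 2.
  rewrite weighted_sum_whipple nm (@whipple_sum_even _ n.*2 unit2 uN) ?prodrXl //.
  by rewrite -nm -addnn leq_addr.
have e0 : \prod_(i < n) ((4 * i%:R + 3) ^+ 2 - 0) =
    16 ^+ n * (\prod_(i < n) (3 * y + i%:R)) ^+ 2 :> R.
  rewrite -prodrXl (_ : 16 ^+ n = \prod_(i < n) 16); last by rewrite prodr_const card_ord.
  rewrite -big_split; apply: eq_bigr => i _ /=.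
  apply: (linear_comb1 (unitr1 R) y4 (c := - (3 * (12 * y + 8 * i%:R + 3)))).
  by ring.
have nE : n%:R = 2 * m%:R :> R by rewrite nm -mul2n natrM.
have ec : m`!%:R * \prod_(i < n) ((4 * i%:R + 3) ^+ 2 - c) =
    (-1) ^+ m * 8 ^+ n * (3 * m)`!%:R * (\prod_(i < m) (2 * i%:R + 1)) ^+ 2 :> R.
  have -> : \prod_(i < n) ((4 * i%:R + 3) ^+ 2 - c) =
      \prod_(i < n) (8 * (m%:R + i%:R + 1) * (2 * i%:R + 1 - n%:R)) :> R.
    by apply: eq_bigr => i _; rewrite pE_ring nE; ring.
  rewrite !big_split prodr_const card_ord /=.
  have -> : m`!%:R * (8 ^+ n * \prod_(i < n) (m%:R + i%:R + 1) *
      \prod_(i < n) (2 * i%:R + 1 - n%:R)) =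
    8 ^+ n * (m`!%:R * \prod_(i < n) (m%:R + i%:R + 1)) *
      \prod_(i < n) (2 * i%:R + 1 - n%:R) :> R by ring.
  have -> : forall k, m`!%:R * \prod_(i < k) (m%:R + i%:R + 1) = (m + k)`!%:R :> R.
    elim=> [|k IH]; first by rewrite big_ord0 addn0 mulr1.
    by rewrite big_ord_recr /= mulrA IH addnS factS natrM -[(m + k).+1%:R]natr1 natrD mulrC.
  (* The factors are the odd numbers from 1-2m to 2m-1; the negative half mirrors the positive
     one. *)
  have -> : \prod_(i < n) (2 * i%:R + 1 - n%:R) =
      (-1) ^+ m * (\prod_(i < m) (2 * i%:R + 1)) ^+ 2 :> R.
    rewrite nm -addnn big_split_ord /= expr2 mulrA; congr (_ * _).
      rewrite (reindex_inj rev_ord_inj) (_ : (-1) ^+ m = \prod_(i < m) -1).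
        rewrite -big_split; apply: eq_bigr => -[i im] _ /=.
        by rewrite natrB // natrD -[i.+1%:R]natr1; ring.
      by rewrite prodr_const card_ord.
    by apply: eq_bigr => i _; rewrite !natrD; ring.
  by rewrite nm -addnn addnA (_ : m + m + m = 3 * m)%N; [ring | lia].
have := unit_odd_prod mn; have := half_ratio_odd mn.
set o := \prod_(i < m) _ in ec * => oE uo.
have cross : 4 ^+ n * n.*2`!%:R * (SA 0 * SB c) = 4 ^+ n * n.*2`!%:R * (SA c * SB 0).
  by rewrite weighted_sum_cross.
rewrite mulrCA neg_sum_prod [RHS]mulrCA neg_sum_prod e0 SAc in cross.
have u8 : 8 \is a @GRing.unit R by rewrite (_ : 8 = 2 * 4); [rewrite rpredM ?unit2 ?unit4 | ring].
have uu : (-1) ^+ m * 8 ^+ n * o ^+ 2 \is a @GRing.unit R.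
  by rewrite !rpredM ?rpredX ?unitrN1.
have sgn : (-1) ^+ m * (-1) ^+ m = 1 :> R by rewrite -expr2 sqrr_sign.
apply: (linear_comb3 uu cross ec sgn (c := m`!%:R ^+ 2) (d := - SA 0 * m`!%:R)
  (e := - (8 ^+ n * o ^+ 2 * (\prod_(i < n) (3 * y + i%:R)) ^+ 2))).
rewrite -oE (_ : 16 ^+ n = (2 ^+ m) ^+ 8 :> R); last first.
  by rewrite (_ : 16 = 2 ^+ 4); [rewrite -!exprM nm -mul2n mulnCA mulnA mulnC | ring].
rewrite (_ : 8 ^+ n = (2 ^+ m) ^+ 6 :> R); last first.
  by rewrite (_ : 8 = 2 ^+ 3); [rewrite -!exprM nm -mul2n mulnCA mulnA mulnC | ring].
by ring.
Qed.

(** * Morita's products modulo p and modulo p^3 *)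

Local Notation gam := (morita_prod R p).
Local Notation w := (prime_part R p).

Lemma prime_part_unit j : w j \is a GRing.unit.
Proof. by rewrite /prime_part; case: ifPn => [_|/up //]; exact: unitr1. Qed.

Lemma natr_addp j : c * (j + p)%:R = c * j%:R :> R.
Proof. by apply: (linear_comb1 (unitr1 R) (sqrp_mulp 1) (c := 1)); rewrite natrD; ring. Qed.

Lemma prime_part_addp j : c * w (j + p) = c * w j.
Proof. by rewrite /prime_part dvdn_addl ?dvdnn //; case: ifP => // _; rewrite natr_addp. Qed.

Lemma prime_part_mod j : c * w (j %% p)%N = c * w j.
Proof.
rewrite [in RHS](divn_eq j p) addnC; elim: (j %/ p)%N => [|k IH]; first by rewrite addn0.
by rewrite mulSn [(p + _)%N]addnC addnA prime_part_addp.
Qed.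

(** Wilson's theorem: p consecutive integers run through all residues modulo p. *)
Lemma prime_part_block a : c * \prod_(i < p) w (a + i) = - c.
Proof.
transitivity (c * \prod_(i < p) w ((a + i) %% p)%N).
  by apply: (@eq_mulr_prod R c p (fun i => w (a + i)) (fun i => w ((a + i) %% p)%N)) => j _;
    rewrite prime_part_mod.
rewrite (@big_ord_shift _ _ _ p (fun j => w (j %% p)%N)); last by move=> j; rewrite modnDr.
have first_factor (F : nat -> R) : \prod_(i < p) F i = F 0%N * \prod_(i < p.-1) F i.+1.
  by case: (p) (prime_gt0 pr_p) => // q _; rewrite big_ord_recl.
rewrite -fact_perturb (first_factor (fun i => w (i %% p)%N)) mod0n.
rewrite {1}/prime_part dvdn0 mul1r fact_prod big_add1 big_mkord natr_prod.
rewrite (_ : n.*2 = p.-1); last by rewrite pE.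
congr (_ * _); apply: eq_bigr => -[i ip] _ /=.
have ip' : (i.+1 < p)%N by rewrite -ltn_predRL.
by rewrite modn_small // /prime_part gtnNdvd.
Qed.

Lemma odd_p : odd p. Proof. by rewrite pE /= odd_double. Qed.

Lemma morita_prod_step a : gam (a + p) = - (\prod_(i < p) w (a + i)) * gam a.
Proof. by rewrite morita_prodD -signr_odd odd_p mulN1r. Qed.

Lemma morita_prod_addp a k : c * gam (a + k * p) = c * gam a.
Proof.
elim: k => [|k IH]; first by rewrite addn0.
rewrite mulSn [(p + _)%N]addnC addnA morita_prod_step -IH.
by rewrite mulrA mulrN prime_part_block opprK.
Qed.

Hypothesis gam_period : forall a, gam (a + p ^ 3) = gam a.

Lemma gam_periodM a k : gam (a + k * p ^ 3) = gam a.
Proof.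
elim: k => [|k IH]; first by rewrite addn0.
by rewrite mulSn [(p ^ 3 + _)%N]addnC addnA gam_period.
Qed.

Lemma natr_mulp3 k : (k * p ^ 3)%:R = 0 :> R.
Proof. by rewrite natrM natrX p3 mulr0. Qed.

(** The reflection formula, squared to absorb its sign: p^3 = 0 makes [w (k * p ^ 3 - a)] equal to
    [w a] up to sign. *)
Lemma morita_prod_reflect k a : (a <= (k * p ^ 3).+1)%N ->
  gam a ^+ 2 * gam ((k * p ^ 3).+1 - a) ^+ 2 = 1.
Proof.
elim: a => [|a IH] aS.
  rewrite subn0 morita_prodS morita_prod0 -[(k * _)%N]add0n gam_periodM morita_prod0.
  by rewrite /prime_part add0n dvdn_mull ?dvdn_exp // mulr1 sqrrN expr1n mulr1.
rewrite -(IH (ltnW aS)) subSS subSn // !morita_prodS !exprMn !sqrrN.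
have -> : w (k * p ^ 3 - a) ^+ 2 = w a ^+ 2.
  rewrite /prime_part dvdn_subr ?dvdn_mull ?dvdn_exp //; case: ifP => // _.
  by rewrite natrB // natr_mulp3 sub0r sqrrN.
by ring.
Qed.

(** The value of Gamma at -m, represented by p^3 - m: the last m factors below p^3 are -m, ...,
    -1. *)
Lemma morita_prod_top m : (m < p)%N -> gam (p ^ 3 - m) * m`!%:R = 1.
Proof.
move=> mp; have mp3 : (m <= p ^ 3)%N.
  by rewrite (leq_trans (ltnW mp)) // -{1}(expn1 p) leq_exp2l // prime_gt1.
have := morita_prodD R p (p ^ 3 - m) m; rewrite subnK //.
rewrite -{1}[(p ^ 3)%N]add0n gam_period morita_prod0 => e.
rewrite [RHS]e mulrC; congr (_ * _).
apply/esym; rewrite fact_prod big_add1 big_mkord natr_prod (reindex_inj rev_ord_inj) /=.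
rewrite (_ : (-1) ^+ m = \prod_(i < m) -1); last by rewrite prodr_const card_ord.
rewrite -big_split; apply: eq_bigr => -[i im] _ /=.
have -> : (p ^ 3 - m + (m - i.+1) = p ^ 3 - i.+1)%N by lia.
rewrite /prime_part dvdn_subr ?dvdn_exp ?(leq_trans im) //.
rewrite gtnNdvd ?(leq_ltn_trans im) // natrB ?(leq_trans im) // natrX p3.
by ring.
Qed.

Definition inv_square (j : nat) : R := if (p %| j)%N then 0 else (j%:R ^+ 2)^-1.

Lemma inv_square_addp j : c * inv_square (j + p) = c * inv_square j.
Proof.
rewrite /inv_square dvdn_addl ?dvdnn //; case: ifPn => // pj.
rewrite -[X in c * X]mul1r -[X in _ = c * X]mul1r.
apply: eq_mulr_div; rewrite ?rpredX ?up ?dvdn_addl ?dvdnn // !mul1r.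
apply: (linear_comb1 (unitr1 R) (sqrp_mulp (2 * j%:R + p%:R)) (c := - 1)).
by rewrite natrD; ring.
Qed.

(* Doubling permutes the residues, so the sum equals a quarter of itself. *)
Lemma sum_inv_square a : (5 <= p)%N -> c * \sum_(i < p) inv_square (a + i) = 0.
Proof.
move=> p5; rewrite mulr_sumr.
rewrite (@big_ord_shift _ _ _ p (fun j => c * inv_square j) a inv_square_addp).
have inv_square_mod j : c * inv_square (j %% p)%N = c * inv_square j.
  rewrite [in RHS](divn_eq j p) addnC; elim: (j %/ p)%N => [|k IH]; first by rewrite addn0.
  by rewrite mulSn [(p + _)%N]addnC addnA inv_square_addp.
have p0 := prime_gt0 pr_p.
pose h (i : 'I_p) := Ordinal (ltn_pmod (2 * i) p0).
have h_inj : injective h.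
  move=> i j /(congr1 val) /= /eqP e; apply: val_inj => /=.
  wlog ij : i j e / (i <= j)%N.
    case: (leqP i j) => [ij|/ltnW ji] /(_ _ _ _ _) hh; first exact: hh.
    by apply/esym/hh; rewrite // eq_sym.
  move: e; rewrite eq_sym eqn_mod_dvd ?leq_mul2l // -mulnBr Gauss_dvdr; last first.
    by rewrite coprime_sym coprime2n odd_p.
  have [|] := posnP (j - i).
    by move/eqP; rewrite subn_eq0 => ji _; apply/eqP; rewrite eqn_leq ij.
  by move=> ji; rewrite gtnNdvd // (leq_ltn_trans (leq_subr _ _)).
set T := \sum_(i < p) _.
have TE : T = \sum_(i < p) c * inv_square (2 * i)%N.
  by rewrite /T (reindex_inj h_inj) /=; apply: eq_bigr => i _; rewrite inv_square_mod.
have T4 : 4 * T = T.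
  rewrite {1}TE mulr_sumr; apply: eq_bigr => i _.
  rewrite /inv_square Gauss_dvdr; last by rewrite coprime_sym coprime2n odd_p.
  case: ifPn => pi; first by rewrite !mulr0.
  have ui := up pi; rewrite natrM exprMn invrM ?rpredX ?unit2 //.
  move: (divrr (rpredX 2 unit2)); set v := _^-1 => uv.
  by apply: (linear_comb1 (unitr1 R) uv (c := c * (i%:R ^+ 2)^-1)); ring.
have u3 : 3 \is a @GRing.unit R by rewrite unit_ltp // (leq_trans _ p5).
apply: (linear_comb1 u3 T4 (c := 1)); ring.
Qed.

(* The two outer factors multiply to v^2 - c, where v is the middle factor. *)
Lemma block_quadratic a : (5 <= p)%N ->
  (\prod_(i < p) w (a + 2 * p + i)) * (\prod_(i < p) w (a + i)) =
  (\prod_(i < p) w (a + p + i)) ^+ 2.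
Proof.
move=> p5; rewrite -big_split -prodrXl /=.
transitivity (\prod_(i < p) w (a + p + i) ^+ 2 * \prod_(i < p) (1 + c * - inv_square (a + i))).
  rewrite -big_split; apply: eq_bigr => i _ /=.
  rewrite /prime_part (_ : a + 2 * p + i = a + i + p + p)%N; last by lia.
  rewrite (_ : a + p + i = a + i + p)%N; last by lia.
  rewrite mulrN -inv_square_addp /inv_square !(dvdn_addl _ (dvdnn p)).
  case: ifPn => [_|pi]; first by ring.
  have ui : (a + i + p)%:R \is a @GRing.unit R by rewrite up // dvdn_addl.
  apply: (linear_comb1 (unitr1 R) (divrr (rpredX 2 ui)) (c := c)).
  by rewrite !natrD; ring.
rewrite -[RHS]mulr1; congr (_ * _).
have prodE k (y : nat -> R) : \prod_(i < k) (1 + c * y i) = 1 + c * \sum_(i < k) y i.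
  elim: k => [|k IH]; first by rewrite !big_ord0 mulr0 addr0.
  rewrite !big_ord_recr /= IH.
  apply: (linear_comb1 (unitr1 R) (sqrp_sqrp (y k * \sum_(i < k) y i)) (c := 1)); ring.
rewrite (prodE p (fun i => - inv_square (a + i))).
by rewrite sumrN mulrN sum_inv_square // oppr0 addr0.
Qed.

(** By [block_quadratic] the ratios of consecutive values [gam (a + k * p)] form a geometric
    progression, so these values are [gam a] times r^k z^C(k,2). The identity then compares
    exponents: 2C(3t,2) = 2C(t,2) + C(4t,2). *)
Lemma morita_prod_quadratic a t : (5 <= p)%N ->
  gam (a + 3 * t * p) ^+ 2 * gam a = gam (a + t * p) ^+ 2 * gam (a + 4 * t * p).
Proof.
move=> p5; pose r t : R := - \prod_(i < p) w (a + t * p + i).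
have ru k : r k \is a GRing.unit.
  by rewrite unitrN rpred_prod // => i _; apply: prime_part_unit.
have gamS k : gam (a + k.+1 * p) = r k * gam (a + k * p).
  by rewrite mulSn [(p + _)%N]addnC addnA morita_prod_step.
have rSS k : r k.+2 * r k = r k.+1 ^+ 2.
  rewrite /r mulrNN sqrrN.
  rewrite (_ : a + k.+2 * p = a + k * p + 2 * p)%N; last by lia.
  rewrite (_ : a + k.+1 * p = a + k * p + p)%N; last by lia.
  exact: block_quadratic.
pose z := r 1%N / r 0%N.
have rS k : r k.+1 = z * r k.
  elim: k => [|k IH]; first by rewrite divrK.
  by apply: (mulIr (ru k)); rewrite rSS expr2 {2}IH; ring.
have rE k : r k = r 0%N * z ^+ k.
  by elim: k => [|k IH]; rewrite ?mulr1 // rS IH exprS; ring.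
have gamE k : gam (a + k * p) = gam a * r 0%N ^+ k * z ^+ 'C(k, 2).
  elim: k => [|k IH]; first by rewrite addn0 !mulr1.
  by rewrite gamS IH rE binS bin1 exprD exprS; ring.
rewrite !gamE.
have -> : r 0%N ^+ (3 * t) = (r 0%N ^+ t) ^+ 3 by rewrite -exprM mulnC.
have -> : r 0%N ^+ (4 * t) = (r 0%N ^+ t) ^+ 4 by rewrite -exprM mulnC.
have zE : (z ^+ 'C(3 * t, 2)) ^+ 2 = (z ^+ 'C(t, 2)) ^+ 2 * z ^+ 'C(4 * t, 2).
  rewrite -!exprM -exprD; congr (_ ^+ _).
  have binE k : ('C(k, 2) * 2 = k * k.-1)%N.
    by elim: k => // k IH; rewrite binS bin1 mulnDl IH; case: k {IH} => // k /=; lia.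
  have := binE (3 * t)%N; have := binE t; have := binE (4 * t)%N.
  by case: t {rE gamE} => [|t]; nia.
apply: (linear_comb1 (unitr1 R) zE (c := gam a ^+ 3 * r 0%N ^+ t ^+ 6)); ring.
Qed.

(** Here [y] represents 1/4. In [morita_prod_quadratic] the base point p^3 - m represents (1-p)/4,
    and steps of [y * p] add p/4. *)
Lemma trunc_sum_mod1 m (y : nat) : (5 <= p)%N -> p = (4 * m).+1 ->
  (4 * y = 3 * p ^ 3 + 1)%N -> SA 0 = - gam y ^+ 4.
Proof.
move=> p5 pm y4.
have nm : n = m.*2 by move: pm; rewrite pE -!mul2n; lia.
have y1 : 4 * y%:R = 1 :> R by rewrite -natrM y4 natrD natr_mulp3 add0r.
have m3p : (3 * m < p)%N by rewrite pm; lia.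
have mp : (m < p)%N by rewrite pm; lia.
have gamP : gam (3 * y + n) = \prod_(i < n) (3 * y%:R + i%:R) * gam (3 * y).
  rewrite morita_prodD nm -signr_odd odd_double mul1r; congr (_ * _).
  apply: eq_bigr => -[i im] _ /=; rewrite /prime_part natrD natrM ifN //.
  have cop : coprime p 4 by rewrite -[4%N]/(2 ^ 2)%N coprimeXr // coprime_sym coprime2n odd_p.
  rewrite -(Gauss_dvdr _ cop) (_ : 4 * _ = 3 * (3 * p ^ 2) * p + (4 * i + 3))%N; last first.
    by rewrite mulnDr (_ : 4 * (3 * y) = 3 * (4 * y))%N ?y4; [rewrite !expnS; lia | lia].
  (* For i < n the number 4i+3 is below 2p, and it differs from p = 4m+1 modulo 4. *)
  rewrite dvdn_addr ?dvdn_mull //; apply/dvdnP => -[q qE].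
  by case: q qE => [|[|q]] qE; move: qE im; rewrite pm -mul2n; nia.
have shift a b k : (a = b + k * p ^ 3)%N -> gam a = gam b by move=> ->; exact: gam_periodM.
have mp3 : (m <= p ^ 3)%N by rewrite (leq_trans (ltnW mp)) // -{1}(expn1 p) leq_exp2l // prime_gt1.
have g1 : gam (p ^ 3 - m + y * p) = gam y.
  apply: (shift _ _ (3 * m + 1)%N); nia.
have g3 : gam (p ^ 3 - m + 3 * y * p) = gam (3 * y + n).
  apply: (shift _ _ (9 * m + 1)%N); rewrite nm -mul2n; nia.
have g4 : gam (p ^ 3 - m + 4 * y * p) = gam (3 * m).+1.
  apply: (shift _ _ (1 + 3 * p)%N); nia.
have := morita_prod_quadratic (p ^ 3 - m) y p5; rewrite g1 g3 g4 gamP morita_prod_fact // => quad.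
have refl : gam y ^+ 2 * gam (3 * y) ^+ 2 = 1.
  have := @morita_prod_reflect 3 y; rewrite (_ : (3 * p ^ 3).+1 - y = 3 * y)%N; last by lia.
  by apply; lia.
have top := morita_prod_top mp.
have sumE := weighted_sum_even nm y1.
have uf : m`!%:R * (3 * m)`!%:R \is a @GRing.unit R by rewrite rpredM ?unit_fact.
apply: (mulIr uf); rewrite sumE.
set P := \prod_(i < n) _ in quad *.
have sgn : (-1) ^+ m * (-1) ^+ (3 * m).+1 = -1 :> R.
  by rewrite -exprD -signr_odd (_ : m + (3 * m).+1 = (m + m).*2.+1)%N ?oddS ?odd_double //; lia.
have -> : P ^+ 2 = gam y ^+ 4 * (-1) ^+ (3 * m).+1 * (m`!%:R * (3 * m)`!%:R).
  apply: (linear_comb3 (unitr1 R) quad refl top (c := gam y ^+ 2 * m`!%:R)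
    (d := - P ^+ 2) (e := - P ^+ 2 * gam (3 * y) ^+ 2 * gam y ^+ 2)).
  by ring.
by apply: (linear_comb1 (unitr1 R) sgn (c := gam y ^+ 4 * (m`!%:R * (3 * m)`!%:R))); ring.
Qed.

(** Modulo p, 1/4 is s+1, where Gamma is s! up to a sign that the fourth power removes; p^2 supplies
    the remaining precision. *)
Lemma trunc_sum_mod3 s (y : nat) : p = (4 * s + 3)%N ->
  (4 * y = p ^ 3 + 1)%N -> 16 * SA 0 = - c * gam y ^+ 4.
Proof.
move=> ps y4.
have ns : n = s.*2.+1 by move: ps; rewrite pE -!mul2n; lia.
rewrite (weighted_sum_odd ns) !mulNr; congr (- _).
have sp : (s < p)%N by rewrite ps; lia.
have yE : (y = s.+1 + (s + 1) * (p - 1) * p)%N by nia.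
have gy : c * gam y = c * gam s.+1 by rewrite yE morita_prod_addp.
have sgn : ((-1) ^+ s.+1) ^+ 2 = 1 :> R by rewrite sqrr_sign.
have -> : s`!%:R ^+ 4 = gam s.+1 ^+ 4.
  rewrite morita_prod_fact //.
  apply: (linear_comb1 (unitr1 R) sgn (c := - (((-1) ^+ s.+1) ^+ 2 + 1) * s`!%:R ^+ 4)).
  by ring.
apply: (linear_comb1 (unitr1 R) gy (c := - (gam y ^+ 3 + gam y ^+ 2 * gam s.+1 +
  gam y * gam s.+1 ^+ 2 + gam s.+1 ^+ 3))).
by ring.
Qed.
End TruncatedSum.

(** * The p-adic Gamma function on residues *)

Section UnitsProduct.
Variables (R : finComUnitRingType).
Hypothesis sqrt1 : forall x : R, x * x = 1 -> x = 1 \/ x = -1.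
Hypothesis one_neqN1 : (1 : R) != -1.

Lemma prod_units : \prod_(x : R | x \is a GRing.unit) x = -1.
Proof.
rewrite (bigID (fun x => x == x^-1)) /=.
have -> : \prod_(x : R | (x \is a GRing.unit) && (x == x^-1)) x = -1.
  rewrite (bigD1 1) ?unitr1 ?invr1 ?eqxx //= (bigD1 (-1)) /=; last first.
    by rewrite unitrN1 invrN1 eqxx eq_sym one_neqN1.
  rewrite big1 ?mul1r ?mulr1 // => x /andP[/andP[/andP[ux /eqP xV] x1] xN1].
  have [xE|xE] := sqrt1 (etrans (congr1 ( *%R x) xV) (divrr ux)).
    by rewrite xE eqxx in x1.
  by rewrite xE eqxx in xN1.
(* The units other than 1 and -1 cancel against their inverses; [enum_rank] selects one from each
   pair. *)
rewrite (bigID (fun x : R => enum_rank x < enum_rank x^-1)%N) /=.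
rewrite [X in _ * (_ * X)](reindex_inj invr_inj) /=.
rewrite [X in _ * (_ * X)](eq_bigl (fun x : R => [&& x \is a GRing.unit, x != x^-1
    & (enum_rank x < enum_rank x^-1)%N])); last first.
  move=> x; rewrite unitrV invrK eq_sym -andbA; case: (x \is a GRing.unit) => //=.
  case: (x =P x^-1) => //= /eqP nx; rewrite -leqNgt leq_eqVlt.
  case: eqP => // /ord_inj /enum_rank_inj e.
  by rewrite {1}e eqxx in nx.
rewrite [X in _ * (X * _)](eq_bigl (fun x : R => [&& x \is a GRing.unit, x != x^-1
    & (enum_rank x < enum_rank x^-1)%N])); last by move=> x; rewrite andbA.
by rewrite -big_split big1 ?mulr1 // => x /andP[ux _] /=; rewrite divrr.
Qed.
End UnitsProduct.

Section PrimePower.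
Variables (p k : nat).
Hypotheses (pr_p : prime p) (odd_p : odd p).
Local Notation N := (p ^ k.+1)%N.
Local Notation Z := 'Z_N.

Lemma prime_power_gt1 : (1 < N)%N.
Proof. by rewrite -{1}(exp1n k.+1) ltn_exp2r // prime_gt1. Qed.

Lemma odd_prime_ndvd2 : ~~ (p %| 2)%N.
Proof. by apply/negP; rewrite dvdn_prime2 // => /eqP p2; have := odd_p; rewrite p2. Qed.

Lemma natr_eq_mod (a b : nat) : (a%:R = b%:R :> Z) <-> (a = b %[mod N])%N.
Proof.
split=> [/(congr1 val) /=|e]; first by rewrite !val_Zp_nat ?prime_power_gt1.
by apply: val_inj; rewrite /= !val_Zp_nat ?prime_power_gt1.
Qed.

Lemma natr_unit_coprime j : ~~ (p %| j)%N -> j%:R \is a @GRing.unit Z.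
Proof. by move=> pj; rewrite unitZpE ?prime_power_gt1 // coprimeXl // prime_coprime. Qed.

Lemma natr_prime_power0 : N%:R = 0 :> Z.
Proof. exact: pchar_Zp prime_power_gt1. Qed.

Lemma Zp_sqrt1 (x : Z) : x * x = 1 -> x = 1 \/ x = -1.
Proof.
have [v ->] : exists v : nat, x = v%:R by exists (val x); rewrite natr_Zp.
case: v => [|v]; first by rewrite mul0r => /esym/eqP; rewrite oner_eq0.
(* Now x = v+1 and x^2 - 1 = v(v+2); the odd prime p divides at most one of these factors. *)
move=> e; have {e} : (N %| v * v.+2)%N.
  have /natr_eq_mod : (v.+1 * v.+1)%:R = 1%:R :> Z by rewrite natrM e.
  move/eqP; rewrite eqn_mod_dvd // (_ : v.+1 * v.+1 - 1 = v * v.+2)%N //; lia.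
have [pv|pv] := boolP (p %| v)%N.
  rewrite mulnC Gauss_dvdr => [Nv|].
    left; apply/(natr_eq_mod _ 1)/eqP; rewrite eqn_mod_dvd // subn1 //.
  rewrite coprimeXl // prime_coprime // -addn2 dvdn_addr //.
  exact: odd_prime_ndvd2.
rewrite Gauss_dvdr ?coprimeXl ?prime_coprime // => Nv; right.
apply/eqP; rewrite -addr_eq0 natr1; apply/eqP.
by case/dvdnP: Nv => q ->; rewrite natrM natr_prime_power0 mulr0.
Qed.

Lemma Zp_one_neqN1 : (1 : Z) != -1.
Proof.
rewrite -addr_eq0 -(natrD _ 1 1); apply/eqP => /(natr_eq_mod 2 0)/eqP.
rewrite mod0n -/(dvdn _ _) => /(dvdn_trans (dvdn_exp _ (dvdnn p))) => /(_ isT).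
exact/negP/odd_prime_ndvd2.
Qed.

Lemma wilson_prime_power : \prod_(i < N) prime_part Z p i = -1.
Proof.
rewrite -(prod_units Zp_sqrt1 Zp_one_neqN1) [RHS]big_mkcond.
transitivity (\prod_(i < (Zp_trunc N).+2) prime_part Z p i).
  by rewrite Zp_cast // prime_power_gt1.
apply: eq_bigr => i _; have -> : (i \is a GRing.unit) = ~~ (p %| i)%N.
  by rewrite -[i in LHS]natr_Zp unitZpE ?prime_power_gt1 // coprime_pexpl // prime_coprime.
by rewrite /prime_part; case: (p %| i)%N; rewrite // natr_Zp.
Qed.

(** The sign (-1)^N and the product over a full period are both -1. *)
Lemma morita_prod_period a : morita_prod Z p (a + N) = morita_prod Z p a.
Proof.
rewrite morita_prodD -signr_odd oddX odd_p orbT expr1.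
rewrite (@big_ord_shift _ _ _ N (prime_part Z p)) ?wilson_prime_power ?mulN1r ?opprK ?mul1r //.
by move=> j; rewrite /prime_part dvdn_addl ?dvdn_exp // natrD natr_prime_power0 addr0.
Qed.

Lemma morita_prod_congr a b : (a = b %[mod N])%N -> morita_prod Z p a = morita_prod Z p b.
Proof.
have red c : morita_prod Z p c = morita_prod Z p (c %% N)%N.
  rewrite {1}(divn_eq c N) addnC; elim: (c %/ N)%N => [|q IH]; first by rewrite addn0.
  by rewrite mulSn [(N + _)%N]addnC addnA morita_prod_period.
by move=> ab; rewrite red ab -red.
Qed.
End PrimePower.

(** * Reduction of p-adic integers and of Gamma *)

(** A name to carry the ring morphism structure. Index n means modulo p^(n+1), so [padic_mod 2] is
    reduction modulo p^3. *)
Definition padic_mod p n (x : padic_int p) : 'Z_(p ^ n.+1) := padic_res x n.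

Section PadicMod.
Variables (p n : nat).
Let padic_mod_zmod : zmod_morphism (@padic_mod p n). Proof. by []. Qed.
Let padic_mod_monoid : monoid_morphism (@padic_mod p n). Proof. by []. Qed.
HB.instance Definition _ := GRing.isZmodMorphism.Build _ _ (@padic_mod p n) padic_mod_zmod.
HB.instance Definition _ := GRing.isMonoidMorphism.Build _ _ (@padic_mod p n) padic_mod_monoid.
End PadicMod.

Section Padic.
Variables (p : nat).
Hypotheses (pr_p : prime p) (odd_p : odd p).
Local Notation Zp := (padic_int p).

Lemma val_padic_red n (a : 'Z_(p ^ n.+2)) : padic_red a = (a %% p ^ n.+1)%N :> nat.
Proof. by congr (_ %% _)%N; rewrite Zp_cast // prime_power_gt1. Qed.

Lemma val_padic_mod (x : Zp) i j : (i <= j)%N ->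
  padic_mod i x = (padic_mod j x %% p ^ i.+1)%N :> nat.
Proof.
move=> ij; rewrite -(subnK ij); elim: (j - i)%N => [|k IH].
  rewrite add0n modn_small // -[X in (_ < X)%N](Zp_cast (prime_power_gt1 i pr_p)).
  exact: ltn_ord.
rewrite IH addSn /padic_mod (padic_res_coherent x (k + i)) val_padic_red modn_dvdm //.
by rewrite dvdn_exp2l // ltnS leq_addl.
Qed.

Lemma padic_mod0_dvd k (x : Zp) : padic_mod k x = 0 -> exists z, x = p%:R ^+ k.+1 * z.
Proof.
move=> x0; pose v n : nat := padic_mod n x.
have vdvd n : (p ^ k.+1 %| v (n + k.+1))%N.
  by rewrite /dvdn -val_padic_mod ?x0 // addnS leqW // leq_addl.
(* Dividing by p^(k+1) costs k+1 digits, so the quotient is read off that many levels higher. *)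
pose t n := (v (n + k.+1) %/ p ^ k.+1)%N.
have vE n : (v (n + k.+1) = p ^ k.+1 * t n)%N by rewrite mulnC divnK.
have ppos : (0 < p ^ k.+1)%N by rewrite expn_gt0 prime_gt0.
have tS n : (t n.+1 = t n %[mod p ^ n.+1])%N.
  have /eqP : (v (n + k.+1) = v (n.+1 + k.+1) %% p ^ (n + k.+1).+1)%N.
    by rewrite /v -val_padic_mod // addSn.
  rewrite !vE -addSn expnD [(p ^ n.+1 * _)%N]mulnC -muln_modr eqn_pmul2l // => /eqP ->.
  by rewrite modn_mod.
have coh n : (t n)%:R = padic_red ((t n.+1)%:R : 'Z_(p ^ n.+2)) :> 'Z_(p ^ n.+1).
  apply: val_inj; rewrite [RHS]val_padic_red val_Zp_nat ?prime_power_gt1 //.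
  rewrite modn_dvdm ?dvdn_exp2l // tS.
  exact: val_Zp_nat (prime_power_gt1 n pr_p) _.
exists (PadicInt coh); apply: padic_int_inj => n.
rewrite -[LHS]/(padic_mod n x) -[RHS]/(padic_mod n (p%:R ^+ k.+1) * (t n)%:R).
rewrite rmorphXn rmorph_nat -natrX -natrM -vE.
rewrite -[LHS]natr_Zp; apply/natr_eq_mod => //.
by rewrite (@val_padic_mod x n (n + k.+1)) ?leq_addr // modn_mod.
Qed.

Lemma eqmodrP k (x y : Zp) : eqmodr (p%:R ^+ k.+1) x y <-> padic_mod k x = padic_mod k y.
Proof.
split=> [[z /(congr1 (@padic_mod p k))]|e].
  rewrite rmorphB rmorphM rmorphXn rmorph_nat -natrX natr_prime_power0 // mul0r.
  by move/eqP; rewrite subr_eq0 => /eqP.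
by apply: padic_mod0_dvd; rewrite -[LHS]/(padic_mod k x - padic_mod k y) e subrr.
Qed.

Lemma padic_natr_unit j : ~~ (p %| j)%N -> j%:R \is a @GRing.unit Zp.
Proof.
move=> pj.
have uj n : j%:R \is a @GRing.unit 'Z_(p ^ n.+1) by rewrite natr_unit_coprime.
have coh n : (j%:R)^-1 = padic_red (j%:R^-1 : 'Z_(p ^ n.+2)) :> 'Z_(p ^ n.+1).
  apply: (mulrI (uj n)); rewrite (divrr (uj n)).
  have -> : j%:R = padic_red (j%:R : 'Z_(p ^ n.+2)) :> 'Z_(p ^ n.+1).
    have := padic_res_coherent (j%:R : Zp) n.
    by rewrite -![padic_res _ _]/(padic_mod _ _) !rmorph_nat.
  by rewrite -padic_redM (divrr (uj n.+1)) padic_red1.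
apply/unitrPr; exists (PadicInt coh); apply: padic_int_inj => n.
by rewrite -[LHS]/(padic_mod n j%:R * j%:R^-1) rmorph_nat (divrr (uj n)).
Qed.

Lemma padic_mod_morita k n :
  padic_mod k (morita_gamma_nat p n) = morita_prod 'Z_(p ^ k.+1) p n.
Proof.
rewrite rmorphM rmorphXn rmorphN1 rmorph_prod; congr (_ * _).
by apply: eq_bigr => i _; rewrite rmorph_nat.
Qed.

Local Open Scope classical_set_scope.

(** By periodicity the values at the residues of x are coherent, and the filter defining Gamma
    converges to the element they form. Hence [lim] is a genuine limit, which can be compared with
    the product at one natural number near x. *)
Lemma morita_gamma_mod (x : Zp) k :
  padic_mod k (morita_gamma x) = morita_prod 'Z_(p ^ k.+1) p (padic_mod k x).
Proof.
have coh n : morita_prod 'Z_(p ^ n.+1) p (padic_mod n x) =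
    padic_red (morita_prod 'Z_(p ^ n.+2) p (padic_mod n.+1 x)).
  have -> : morita_prod 'Z_(p ^ n.+2) p (padic_mod n.+1 x) =
      padic_res (morita_gamma_nat p (padic_mod n.+1 x)) n.+1 by rewrite -padic_mod_morita.
  rewrite -padic_res_coherent -[RHS]/(padic_mod n _) padic_mod_morita.
  by apply: morita_prod_congr; rewrite // (val_padic_mod x (leqnSn n)) modn_mod.
pose F : set_system (padic_int p) := morita_gamma_nat p n @[n --> nat_nbhs x].
have cvgF : F --> PadicInt coh.
  move=> A [i _ iA]; exists [set y | eqmodr (p%:R ^+ i.+1) y x].
    by exists i.+1.
  move=> n /= /eqmodrP nx; apply: iA => /=.
  have /eqmodrP [z zE] : padic_mod i (morita_gamma_nat p n) = padic_mod i (PadicInt coh).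
    rewrite padic_mod_morita; apply: morita_prod_congr => //.
    by apply/natr_eq_mod => //; rewrite natr_Zp -nx rmorph_nat.
  by exists (p%:R * z); rewrite zE exprSr mulrA.
have /cvgP : F --> PadicInt coh by [].
move=> /(_ [set y | eqmodr (p%:R ^+ k.+1) y (lim F)]) [].
  by exists k.+1.
move=> A [i _ iA] /= AF.
pose a : nat := padic_mod (i + k) x.
have aA : A a%:R.
  apply: iA => /=; case: i {AF} @a => [|i] a.
    by exists (a%:R - x); rewrite mul1r.
  apply/eqmodrP; rewrite rmorph_nat -[RHS]natr_Zp; apply/natr_eq_mod => //.
  by rewrite (@val_padic_mod x i (i.+1 + k)) ?modn_mod // addSn leqW // leq_addr.
have /eqmodrP := AF _ aA; rewrite padic_mod_morita => <-.
apply: morita_prod_congr => //.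
by rewrite (@val_padic_mod x k (i + k)) ?modn_mod // leq_addl.
Qed.
End Padic.

(** * Transfer of the congruences to the p-adic integers *)

Lemma pochhammer1 (R : comNzRingType) k : pochhammer (1 : R) k = k`!%:R.
Proof.
elim: k => [|k IH]; first by rewrite /pochhammer big_ord0.
by rewrite /pochhammer big_ord_recr /= -/(pochhammer 1 k) IH factS natrM nat1r mulrC.
Qed.

Lemma clausen_truncE (R : comUnitRingType) n :
  (forall k, (k <= n)%N -> k`!%:R \is a @GRing.unit R) ->
  hypergeometric_trunc [:: 2^-1; 2^-1; 2^-1] [:: 1; 1] (1 : R) n =
  \sum_(0 <= k < n.+1) pochhammer (2^-1) k ^+ 3 / k`!%:R ^+ 3.
Proof.
move=> uf; rewrite big_mkord; apply: eq_bigr => -[k kn] _ /=.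
rewrite !big_cons !big_nil !pochhammer1 expr1n !mulr1.
by congr (_ / _); ring.
Qed.

Section TruncMod.
Variables (p : nat).
Hypotheses (pr_p : prime p) (odd_p : odd p).
Local Notation R := 'Z_(p ^ 3).

Lemma padic_fact_unit k : (k < p)%N -> k`!%:R \is a @GRing.unit (padic_int p).
Proof.
elim: k => [|k IH] kp; first exact: unitr1.
by rewrite factS natrM rpredM ?IH ?(ltnW kp) // padic_natr_unit // gtnNdvd.
Qed.

Lemma padic_mod_clausen :
  padic_mod 2 (\sum_(0 <= k < p) pochhammer (2^-1 : padic_int p) k ^+ 3 / k`!%:R ^+ 3) =
  \sum_(0 <= k < p) (\prod_(i < k) (2^-1 + i%:R : R)) ^+ 3 / k`!%:R ^+ 3.
Proof.
rewrite rmorph_sum !big_mkord; apply: eq_bigr => -[k kp] _ /=.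
have uk := padic_fact_unit kp.
have u2 : 2 \is a @GRing.unit (padic_int p) by rewrite padic_natr_unit // odd_prime_ndvd2.
rewrite -[LHS]/(padic_mod 2 (pochhammer (2^-1) k ^+ 3 / k`!%:R ^+ 3)).
rewrite rmorphM rmorphXn (rmorphV _ (rpredX 3 uk)) rmorphXn rmorph_nat; congr (_ ^+ 3 / _).
by rewrite rmorph_prod; apply: eq_bigr => i _; rewrite rmorphD rmorph_nat (rmorphV _ u2) rmorph_nat.
Qed.

Lemma morita_gamma_quarter y : (4 * y = 1 %[mod p ^ 3])%N ->
  padic_mod 2 (morita_gamma (4^-1 : padic_int p)) = morita_prod R p y.
Proof.
move=> y4; rewrite morita_gamma_mod //; apply: morita_prod_congr => //.
have u4 : 4 \is a @GRing.unit (padic_int p).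
  by rewrite padic_natr_unit // -[4%N]/(2 ^ 2)%N Euclid_dvdX // negb_and odd_prime_ndvd2.
have u4' : 4 \is a @GRing.unit R.
  by rewrite natr_unit_coprime // -[4%N]/(2 ^ 2)%N Euclid_dvdX // negb_and odd_prime_ndvd2.
apply: (proj1 (@natr_eq_mod p 2 pr_p (padic_mod 2 4^-1) y)).
rewrite natr_Zp (rmorphV _ u4) rmorph_nat.
apply: (mulrI u4'); rewrite divrr // -natrM.
exact: (esym (proj2 (@natr_eq_mod p 2 pr_p (4 * y) 1) y4)).
Qed.
End TruncMod.

Theorem theorem1p3 (p : nat) (p_prime : prime p) (p_ge5 : (5 <= p)%N) :
  let F : padic_int p :=
    hypergeometric_trunc [:: 2^-1; 2^-1; 2^-1] [:: 1; 1] 1 p.-1 in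
  [/\ F = \sum_(0 <= k < p) pochhammer (2^-1) k ^+ 3 / k`!%:R ^+ 3,
      (p = 1 %[mod 4])%N ->
        eqmodr (p%:R ^+ 3) F (- morita_gamma (4^-1 : padic_int p) ^+ 4)
    & (p = 3 %[mod 4])%N ->
        eqmodr (p%:R ^+ 3) F
          (- (p%:R ^+ 2 / 16) * morita_gamma (4^-1 : padic_int p) ^+ 4)].
Proof.
set R := 'Z_(p ^ 3).
have odd_p : odd p by case/even_prime: (p_prime) p_ge5 => [->|].
have p0 := prime_gt0 p_prime.
have up j : ~~ (p %| j)%N -> j%:R \is a @GRing.unit R.
  by move=> pj; rewrite (@natr_unit_coprime p 2).
have p3 : p%:R ^+ 3 = 0 :> R by rewrite -natrX (@natr_prime_power0 p 2).
have per a : morita_prod R p (a + p ^ 3) = morita_prod R p a.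
  exact: (@morita_prod_period p 2).
have [n pE] : exists n, p = n.*2.+1.
  by exists p./2; rewrite -[LHS]odd_double_half odd_p.
move=> F; have FE : F = \sum_(0 <= k < p) pochhammer (2^-1) k ^+ 3 / k`!%:R ^+ 3.
  rewrite /F clausen_truncE ?prednK // => k kp.
  by apply: padic_fact_unit; rewrite // -[p]prednK // ltnS.
have FS : padic_mod 2 F = weighted_sum n (@half_ratio R) 0.
  by rewrite FE padic_mod_clausen // (trunc_sumE p_prime pE p3 up).
have gammaX y : (4 * y = 1 %[mod p ^ 3])%N ->
    padic_mod 2 (morita_gamma (4^-1 : padic_int p) ^+ 4) = morita_prod R p y ^+ 4.
  by move=> y4; rewrite -(morita_gamma_quarter p_prime odd_p y4) rmorphXn.
split=> // p4; apply/eqmodrP => //; rewrite FS.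
  pose m := (p %/ 4)%N; have pm : p = (4 * m).+1.
    by rewrite [LHS](divn_eq p 4) p4 mulnC addn1.
  (* As p = 1 mod 4, the coefficient 3 makes the right side divisible by 4. *)
  have [y yE] : exists y, (4 * y = 3 * p ^ 3 + 1)%N.
    exists ((3 * p ^ 3 + 1) %/ 4)%N; rewrite mulnC divnK // /dvdn -modnDml -modnMmr -modnXm p4.
    by rewrite modnMmr modnDml.
  have y1 : (4 * y = 1 %[mod p ^ 3])%N by rewrite yE modnMDl.
  rewrite -[RHS]/(- padic_mod 2 (morita_gamma (4^-1 : padic_int p) ^+ 4)) (gammaX y y1).
  exact: (trunc_sum_mod1 p_prime pE p3 up per p_ge5 pm yE).
pose s := (p %/ 4)%N; have ps : p = (4 * s + 3)%N.
  by rewrite [LHS](divn_eq p 4) p4 mulnC.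
(* As p = 3 mod 4, also p^3 = 3 mod 4, so the coefficient 1 suffices. *)
have [y yE] : exists y, (4 * y = p ^ 3 + 1)%N.
  exists ((p ^ 3 + 1) %/ 4)%N; rewrite mulnC divnK // /dvdn -modnDml -modnXm p4.
  by rewrite modnXm modnDml.
have ndvd16 : ~~ (p %| 16)%N.
  by rewrite -[16%N]/(2 ^ 4)%N Euclid_dvdX // negb_and odd_prime_ndvd2.
have y1 : (4 * y = 1 %[mod p ^ 3])%N by rewrite yE modnDl.
rewrite -[RHS]/(- padic_mod 2 (p%:R ^+ 2 / 16) *
  padic_mod 2 (morita_gamma (4^-1 : padic_int p) ^+ 4)) (gammaX y y1).
rewrite rmorphM rmorphXn (rmorphV _ (padic_natr_unit p_prime ndvd16)) !rmorph_nat.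
have := trunc_sum_mod3 p_prime pE p3 up ps yE => e.
apply: (mulrI (up _ ndvd16)); rewrite e.
apply: (linear_comb1 (unitr1 R) (divrr (up _ ndvd16)) (c := p%:R ^+ 2 * morita_prod R p y ^+ 4)).
ring.
Qed.
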